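(* (i) If $F$ is monotone, then $\mathrm{D}H_\mu(x,y)$ is nonsingular for all $\mu>0$ and $(x,y)\in\mathbb{E}\times\mathbb{E}$. (ii) If $F$ is strongly monotone and $\{\mathrm{D}F(x^{(k)})\}_{k\ge0}$ is bounded, where $\{w^{(k)}=(x^{(k)},y^{(k)})\}_{k\ge0}$ and $\{\mu_k\}_{k\ge0}$, $\mu_k>0$, are the sequences generated by the Algorithm, then $\mathrm{D}H_{\mu_k}(w^{(k)})$ is nonsingular for all $k$ and there exists a constant $C$ such that $\|\mathrm{D}H_{\mu_k}(w^{(k)})^{-1}\|\le C$ for all $k$.
   Context: **Setting.** $\mathbb{E}$ is a finite-dimensional real vector space with inner product $\langle\cdot,\cdot\rangle$ and induced norm $\|\cdot\|$; on $\mathbb{E}\times\mathbb{E}$, $\|(a,b)\|=\sqrt{\|a\|^2+\|b\|^2}$, and linear operators carry the operator norm. $X\subset\mathbb{E}$ is a closed convex set with nonempty interior, $\Pi_X$ is the Euclidean projection onto $X$, and $F:\mathbb{E}\to\mathbb{E}$ is continuously differentiable. $F$ is monotone if $\langle F(x)-F(y),x-y\rangle\ge0$ for all $x,y$, and strongly monotone if for some $\varrho>0$, $\langle F(x)-F(y),x-y\rangle\ge\varrho\|x-y\|^2$ for all $x,y$. $\mathrm{D}$ denotes the Fréchet derivative. A barrier of $X$ is a function $f:\mathrm{int}(X)\to\mathbb{R}$ with $f(x_k)\to\infty$ for any sequence $\{x_k\}\subset\mathrm{int}(X)$ converging to a boundary point of $X$. A barrier $f$ is a $\vartheta$-self-concordant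 barrier if it is three times continuously differentiable, $\vartheta=\inf\{t\ge0: t\langle h,\nabla^2f(x)h\rangle-\langle\nabla f(x),h\rangle^2\ge0\ \forall x\in\mathrm{int}(X),h\in\mathbb{E}\}$ is finite, and $|\mathrm{D}^3f(x)[h,h,h]|\le2(\mathrm{D}^2f(x)[h,h])^{3/2}$ for all $x\in\mathrm{int}(X)$, $h\in\mathbb{E}$. Fix a $\vartheta$-self-concordant barrier $f$ of $X$. For $\mu>0$ and $z\in\mathbb{E}$, $p_\mu(z)\in\mathrm{int}(X)$ is the unique solution of $p_\mu(z)+\mu^2\nabla f(p_\mu(z))=z$; also $p_0(z)=\Pi_X(z)$. For $\mu\ge0$ and $w=(x,y)\in\mathbb{E}\times\mathbb{E}$: $\phi_\mu(x,y)=x-p_\mu(x-y)$, $H_\mu(x,y)=(\phi_\mu(x,y),\,F(x)-y)$, $\Psi_\mu(x,y)=\|F(x)-y\|+\|\phi_\mu(x,y)\|$, $\mathcal N(\beta,\mu)=\{(x,y):\Psi_\mu(x,y)\le\beta\mu\}$. **Algorithm.** Given $\sigma,\alpha_1,\alpha_2,\alpha_3\in(0,1)$ and sequences $\{\theta_1^{(k)}\},\{\theta_2^{(k)}\}\subset(0,1)$ with $\sigma+\sqrt2\sup_k\theta_1^{(k)}<1$. Write $w^{(k)}=(x^{(k)},y^{(k)})$. Step 0. Set $k=0$; choose $\mu_0>0$, $w^{(0)}\in\mathbb{E}\times\mathbb{E}$, $\beta>\sqrt\vartheta$ with $w^{(0)}\in\mathcal N(\beta,\mu_0)$. Step 1.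 If $H_0(w^{(k)})=0$, terminate. Else if $\Psi_{\mu_k}(w^{(k)})=0$, set $\tilde w^{(k+1)}=w^{(k)}$ and go to Step 3. Else let $\triangle\tilde w^{(k)}$ solve $-H_{\mu_k}(w^{(k)})+r_1^{(k)}=\mathrm{D}H_{\mu_k}(w^{(k)})[\triangle\tilde w^{(k)}]$, where $\|r_1^{(k)}\|\le\theta_1^{(k)}\|H_{\mu_k}(w^{(k)})\|$. Step 2. Let $\lambda_k$ be the maximum of $1,\alpha_1,\alpha_1^2,\dots$ such that $\Psi_{\mu_k}(w^{(k)}+\lambda_k\triangle\tilde w^{(k)})\le(1-\sigma\lambda_k)\Psi_{\mu_k}(w^{(k)})$. Set $\tilde w^{(k+1)}=w^{(k)}+\lambda_k\triangle\tilde w^{(k)}$. Step 3. Let $\gamma_k$ be the maximum of $1,\alpha_2,\alpha_2^2,\dots$ such that $\tilde w^{(k+1)}\in\mathcal N(\beta,(1-\gamma_k)\mu_k)$. Set $\tilde\mu_{k+1}=(1-\gamma_k)\mu_k$. Step 4. Let $\triangle\hat w^{(k)}$ solve $-H_0(w^{(k)})+r_2^{(k)}=\mathrm{D}H_{\mu_k}(w^{(k)})[\triangle\hat w^{(k)}]$, where $\|r_2^{(k)}\|\le\theta_2^{(k)}\|H_0(w^{(k)})\|$. Set $\hat w^{(k+1)}=w^{(k)}+\triangle\hat w^{(k)}$. Step 5. If $\hat w^{(k+1)}\notin\mathcal N(\beta,\tilde\mu_{k+1})$, set $\mu_{k+1}=\tilde\mu_{k+1}$, $w^{(k+1)}=\tilde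 w^{(k+1)}$, $k=k+1$, return to Step 1. Else if $H_0(\hat w^{(k+1)})=0$, terminate. Else let $\eta_k$ be the greatest of $1,\alpha_3,\alpha_3^2,\dots$ such that $\hat w^{(k+1)}\notin\mathcal N(\beta,\eta_k\alpha_3\tilde\mu_{k+1})$; set $\mu_{k+1}=\eta_k\tilde\mu_{k+1}$, $w^{(k+1)}=\hat w^{(k+1)}$, $k=k+1$, return to Step 1. (If some $\mu_k=0$, the algorithm terminates at that iterate with $H_0(w^{(k)})=0$.)
   Formalization: Part (i) additionally assumes that X contains no straight line; without this it is false (X = E = R, f = 0, F = 0 gives H_mu(x,y) = (y,-y), with singular derivative). *)

(* Defs.v *)
From mathcomp Require Export all_boot all_order all_algebra sesquilinear.
From mathcomp Require Export all_classical all_reals all_analysis.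
Import Order.TTheory GRing.Theory Num.Theory.
Export numFieldNormedType.Exports.

Set Implicit Arguments.
Unset Strict Implicit.
Unset Printing Implicit Defensive.

Local Open Scope classical_set_scope.
Local Open Scope ring_scope.

(* A finite-dimensional inner product space is a [normedModType R] spanned by
   finitely many vectors, with an inner product [dot : {dot E for idfun}] that
   induces its norm ([dot x x = `|x| ^+ 2]). *)
Definition finite_dimensional (R : realType) (E : lmodType R) : Prop :=
  exists n (e : 'I_n -> E), forall x, exists c : 'I_n -> R,
    x = \sum_(i < n) c i *: e i.

Section Calculus.
Context {R : realType}.

(* [g] is n times continuously differentiable on the open set [U]. In finite
   dimension, continuity (differentiability) of the linear-map-valued function
   [x |-> 'd g x] is the same as that of [x |-> 'd g x h] for every [h]. *)
Fixpoint Ck {V W : normedModType R} (n : nat) (U : set V) (g : V -> W) : Prop :=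
  if n is m.+1 then
    (forall x, U x -> differentiable g x) /\
    (forall h, Ck m U (fun x => 'd g x h))
  else forall x, U x -> {for x, continuous g}.

(* The library norm of [E * E] is the maximum of the two norms; it defines the
   same topology (hence the same Frechet derivatives) as the norm below. *)
Definition pnorm {V : normedModType R} (w : V * V) : R :=
  Num.sqrt (`|w.1| ^+ 2 + `|w.2| ^+ 2).

(* Operator norm with respect to the norms [nV] and [nW]; extended-real-valued,
   so that boundedness is never an artefact of [sup] on unbounded sets. *)
Definition opnorm {V W : lmodType R} (nV : V -> R) (nW : W -> R)
    (A : V -> W) : \bar R :=
  ereal_sup [set (nW (A v))%:E | v in [set v | nV v <= 1]].

Definition inverse {V W : normedModType R} (A : V -> W) (y : W) : V :=
  get [set x | A x = y].

(* If [g] is not differentiable at [x] then ['d g x] is a dummy value, hence the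
   first conjunct. *)
Definition nonsingular_diff {V W : normedModType R} (g : V -> W) (x : V) : Prop :=
  differentiable g x /\ bijective ('d g x).

End Calculus.

Section Barrier.
Context {R : realType} {E : normedModType R} (dot : {dot E for idfun}).

Definition monotone (F : E -> E) : Prop :=
  forall x y, 0 <= dot (F x - F y) (x - y).

Definition strongly_monotone (F : E -> E) : Prop :=
  exists2 rho : R, 0 < rho &
    forall x y, rho * `|x - y| ^+ 2 <= dot (F x - F y) (x - y).

(* The Hessian of a self-concordant barrier of [X] is positive definite exactly
   when [X] contains no line. If it does, a merely monotone [F] can give a
   singular derivative: for [X = E], [f = 0], [F = 0], [H_mu(x, y) = (y, -y)]. *)
Definition contains_no_line (X : set E) : Prop :=
  forall x h, h != 0 -> ~ (forall t : R, X (x + t *: h)).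

Definition grad (f : E -> R) (x : E) : E :=
  get [set g | forall h, dot g h = 'd f x h].

Definition D2 (f : E -> R) (x h1 h2 : E) : R :=
  'd (fun y => 'd f y h1) x h2.

Definition D3 (f : E -> R) (x h1 h2 h3 : E) : R :=
  'd (fun y => D2 f y h1 h2) x h3.

(* A function on the interior [X°] is represented by a total function, of which
   only the values on [X°] are ever used. *)
Definition barrier (X : set E) (f : E -> R) : Prop :=
  forall (u : nat -> E) (b : E), (forall k, X° (u k)) ->
    (closure X `\` X°) b -> u @ \oo --> b -> f (u k) @[k --> \oo] --> +oo%R.

Definition barrier_parameters (X : set E) (f : E -> R) : set R :=
  [set t | 0 <= t /\ forall x h, X° x ->
     0 <= t * dot h ('d (grad f) x h) - dot (grad f x) h ^+ 2].

Definition self_concordant_barrier (X : set E) (f : E -> R) (theta : R) : Prop :=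
  [/\ barrier X f,
      Ck 3 X° f,
      barrier_parameters X f !=set0,
      theta = inf (barrier_parameters X f) &
      forall x h, X° x -> `|D3 f x h h h| <= 2 * (D2 f x h h) `^ (3 / 2)].

Definition is_projection (X : set E) (z p : E) : Prop :=
  X p /\ forall q, X q -> `|z - p| <= `|z - q|.

Definition p_ (X : set E) (f : E -> R) (mu : R) (z : E) : E :=
  if mu == 0 then get [set p | is_projection X z p]
  else get [set p | X° p /\ p + mu ^+ 2 *: grad f p = z].

Definition phi (X : set E) (f : E -> R) (mu : R) (w : E * E) : E :=
  w.1 - p_ X f mu (w.1 - w.2).

Definition H_ (X : set E) (f : E -> R) (F : E -> E) (mu : R) (w : E * E) : E * E :=
  (phi X f mu w, F w.1 - w.2).

Definition Psi (X : set E) (f : E -> R) (F : E -> E) (mu : R) (w : E * E) : R :=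
  `|F w.1 - w.2| + `|phi X f mu w|.

Definition nbhd (X : set E) (f : E -> R) (F : E -> E) (beta mu : R) : set (E * E) :=
  [set w | Psi X f F mu w <= beta * mu].

End Barrier.

Section Algorithm.
Context {R : realType}.

Record alg_data := AlgData {
  sigma : R; alpha1 : R; alpha2 : R; alpha3 : R;
  theta1 : nat -> R; theta2 : nat -> R;
  beta : R }.

Definition admissible (vartheta : R) (d : alg_data) : Prop :=
  [/\ [/\ 0 < sigma d < 1, 0 < alpha1 d < 1, 0 < alpha2 d < 1 & 0 < alpha3 d < 1],
      forall k, 0 < theta1 d k < 1,
      forall k, 0 < theta2 d k < 1,
      sigma d + Num.sqrt 2 * sup (range (theta1 d)) < 1 &
      Num.sqrt vartheta < beta d].

(* [t] is the greatest of [1, a, a ^+ 2, ...] satisfying [P]. *)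
Definition greatest_power (a : R) (P : R -> Prop) (t : R) : Prop :=
  [/\ exists j, t = a ^+ j, P t & forall i, P (a ^+ i) -> a ^+ i <= t].

Context {E : normedModType R} (dot : {dot E for idfun}).
Context (X : set E) (f : E -> R) (F : E -> E) (d : alg_data).

Let H := H_ dot X f F.
Let Psi := Psi dot X f F.
Let N := nbhd dot X f F (beta d).

Definition newton_step (k : nat) (mu : R) (w w1 : E * E) : Prop :=
  if Psi mu w == 0 then w1 = w else
  exists (dw r1 : E * E) (lambda : R),
    [/\ pnorm r1 <= theta1 d k * pnorm (H mu w),
        - H mu w + r1 = 'd (H mu) w dw,
        greatest_power (alpha1 d)
          (fun l => Psi mu (w + l *: dw) <= (1 - sigma d * l) * Psi mu w) lambda &
        w1 = w + lambda *: dw].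

Definition mu_step (mu : R) (w1 : E * E) (mu1 : R) : Prop :=
  exists2 gamma,
    greatest_power (alpha2 d) (fun g => N ((1 - g) * mu) w1) gamma &
    mu1 = (1 - gamma) * mu.

Definition predictor_step (k : nat) (mu : R) (w w2 : E * E) : Prop :=
  exists dw r2 : E * E,
    [/\ pnorm r2 <= theta2 d k * pnorm (H 0 w),
        - H 0 w + r2 = 'd (H mu) w dw &
        w2 = w + dw].

Definition select_step (w1 : E * E) (mu1 : R) (w2 : E * E)
    (mu' : R) (w' : E * E) : Prop :=
  [/\ ~ N mu1 w2, mu' = mu1 & w' = w1] \/
  [/\ N mu1 w2, H 0 w2 <> 0, w' = w2 &
      exists2 eta,
        greatest_power (alpha3 d) (fun e => ~ N (e * alpha3 d * mu1) w2) eta &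
        mu' = eta * mu1].

(* Iteration [k] does not terminate and leads from [(mu, w)] to [(mu', w')]. *)
Definition alg_step (k : nat) (mu : R) (w : E * E) (mu' : R) (w' : E * E) : Prop :=
  H 0 w <> 0 /\
  exists (w1 w2 : E * E) (mu1 : R),
    [/\ newton_step k mu w w1,
        mu_step mu w1 mu1,
        predictor_step k mu w w2 &
        select_step w1 mu1 w2 mu' w'].

(* [stop = None] describes an infinite run, and [stop = Some n] a run whose
   iterates have the indices [0, ..., n]; the values of the sequences at other
   indices are irrelevant. *)
Definition index_of_run (stop : option nat) (k : nat) : Prop :=
  if stop is Some n then (k <= n)%N else True.

(* Finite runs are not required to be complete: initial segments are allowed. *)
Definition generated (stop : option nat) (mu : nat -> R) (w : nat -> E * E) : Prop :=
  [/\ 0 < mu 0%N,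
      N (mu 0%N) (w 0%N) &
      forall k, index_of_run stop k.+1 ->
        alg_step k (mu k) (w k) (mu k.+1) (w k.+1)].

End Algorithm.

(* Main.v *)
From HB Require Import structures.
Require Import Defs.
From mathcomp Require Import ring lra.
Import Order.TTheory GRing.Theory Num.Theory.

Set Implicit Arguments.
Unset Strict Implicit.
Unset Printing Implicit Defensive.

Local Open Scope classical_set_scope.
Local Open Scope ring_scope.

(** Write [c = mu^2], [L] for the Hessian of [f] at [p_mu z] and [K = c L >= 0].
    The map [G p = p + c grad f p] is a bijection from the interior of [X] onto
    [E]: a preimage of [z] minimizes [c f + |. - z|^2 / 2], whose sublevel sets
    are compact by the barrier property. As [G] expands distances, its inverse
    [p_mu] is 1-Lipschitz and has the derivative [(I + K)^-1] at [z]. With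
    [s = u - a], the system [DH_mu (u, v) = (a, b)] then reads
    [(DF + K) s = a + b - DF a] and [v = a - K s], so it suffices to control
    [DF + K] from below. If [F] is strongly monotone, [DF] alone gives the bound
    [rho], uniformly in the iterates.
    If [F] is only monotone, [K] must be positive definite: when [D2 f x h h = 0],
    self-concordance propagates this along the line through [x] directed by [h],
    where [f] is then affine, so the barrier property keeps the whole line inside
    [X]. *)

(** * Finite-dimensional inner product spaces: bases, duality, compactness *)

Section InnerProduct.
Context {R : realType} {E : normedModType R} (dot : {dot E for idfun}).

Lemma dotC x y : dot x y = dot y x.
Proof. by rewrite hermitian_subproof /= expr0 mul1r. Qed.

Lemma dotDl x y z : dot (x + y) z = dot x z + dot y z.
Proof. by rewrite linearDl. Qed.

Lemma dotZl a x z : dot (a *: x) z = a * dot x z.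
Proof. by rewrite linearZl. Qed.

Lemma dotDr x y z : dot z (x + y) = dot z x + dot z y.
Proof. by rewrite dotC dotDl !(dotC z). Qed.

Lemma dotZr a x z : dot z (a *: x) = a * dot z x.
Proof. by rewrite dotC dotZl (dotC z). Qed.

Lemma dot0l z : dot 0 z = 0.
Proof. by rewrite linear0l. Qed.

Lemma dotBl x y z : dot (x - y) z = dot x z - dot y z.
Proof. by rewrite -scaleN1r dotDl dotZl mulN1r. Qed.

Lemma dot_suml I (r : seq I) (P : pred I) (g : I -> E) z :
  dot (\sum_(i <- r | P i) g i) z = \sum_(i <- r | P i) dot (g i) z.
Proof. exact: (big_morph (dot^~ z) (fun x y => dotDl x y z) (dot0l z)). Qed.

Lemma dot_orthonormal n (b : 'I_n -> E) (r : 'I_n -> R) j :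
  (forall i j, dot (b i) (b j) = (i == j)%:R) ->
  dot (\sum_(i < n) r i *: b i) (b j) = r j.
Proof.
move=> ob; rewrite dot_suml (bigD1 j)//= dotZl ob eqxx mulr1 big1 ?addr0//.
by move=> i ij; rewrite dotZl ob (negbTE ij) mulr0.
Qed.

Context (dot_norm : forall x : E, dot x x = `|x| ^+ 2).

(** Squaring the triangle inequality and expanding leaves Cauchy-Schwarz. *)
Lemma dot_le_norm x y : dot x y <= `|x| * `|y|.
Proof.
have : `|x + y| ^+ 2 <= (`|x| + `|y|) ^+ 2.
  by rewrite ler_sqr ?nnegrE ?addr_ge0// ler_normD.
by rewrite -dot_norm dotDl !dotDr (dotC y x) !dot_norm; nra.
Qed.

Lemma abs_dot_le_norm x y : `|dot x y| <= `|x| * `|y|.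
Proof.
rewrite ler_norml dot_le_norm andbT lerNl -mulN1r -dotZl scaleN1r.
by rewrite -(normrN x) dot_le_norm.
Qed.

Lemma dot_continuous h : continuous (dot h).
Proof.
apply: bounded_linear_continuous; apply/linear_boundedP; near=> r => x.
rewrite (le_trans (abs_dot_le_norm _ _))// ler_wpM2r//.
Unshelve. all: by end_near. Qed.

(** Induction on the list: the residual [w] of the new vector either vanishes, and the family is
    kept, or is normalized and added. The list may thus be linearly dependent. *)
Lemma Gram_Schmidt (s : seq E) : exists n (b : 'I_n -> E),
  (forall i j, dot (b i) (b j) = (i == j)%:R) /\
  forall x, x \in s -> x = \sum_(i < n) dot x (b i) *: b i.
Proof.
elim: s => [|v s [n [b [ob sb]]]].
  by exists 0%N, (fun=> 0); split => [[]//|//].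
set w := v - \sum_(i < n) dot v (b i) *: b i.
have wb j : dot w (b j) = 0 by rewrite dotBl dot_orthonormal// subrr.
have [w0|w0] := eqVneq w 0.
  exists n, b; split=> // x; rewrite inE => /orP[/eqP->|]; last exact: sb.
  by apply/eqP; rewrite -subr_eq0 -/w w0.
pose u := `|w|^-1 *: w.
have uu : dot u u = 1.
  by rewrite dotZl dotZr dot_norm; field; rewrite normr_eq0.
have ub j : dot u (b j) = 0 by rewrite dotZl wb mulr0.
(* Vectors already expanded in [b] have coefficient zero along [u], so their expansions survive the
   extension. *)
have span_u x : x = \sum_(i < n) dot x (b i) *: b i -> dot x u = 0.
  move=> ->; rewrite dot_suml big1// => i _.
  by rewrite dotZl (dotC (b i)) ub mulr0.
exists n.+1, (fun i => oapp b u (unlift ord0 i)); split=> [i j|x].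
  case: unliftP => [i' ->|->]; case: unliftP => [j' ->|->] /=.
  - by rewrite ob (inj_eq lift_inj).
  - by rewrite dotC ub -[LHS]/(0%:R); congr _%:R.
  - by rewrite ub -[LHS]/(0%:R); congr _%:R.
  - by rewrite uu.
rewrite big_ord_recl /= unlift_none /=.
under eq_bigr do rewrite liftK /=.
rewrite inE => /orP[/eqP->|/sb xs]; last by rewrite span_u// scale0r add0r.
set p := \sum_(i < n) _.
have vE : v = w + p by rewrite subrK.
have -> : dot v u = dot w u.
  rewrite vE dotDl [dot p u]dot_suml big1 ?addr0// => i _.
  by rewrite dotZl (dotC (b i)) ub mulr0.
rewrite [LHS]vE dotZr dot_norm scalerA; congr (_ + _).
by rewrite (_ : _ * _ = 1) ?scale1r//; field; rewrite normr_eq0.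
Qed.

Context (findimE : finite_dimensional E).

Lemma orthonormal_basis : exists n (b : 'I_n -> E),
  (forall i j, dot (b i) (b j) = (i == j)%:R) /\
  forall x, x = \sum_(i < n) dot x (b i) *: b i.
Proof.
have [m [e spane]] := findimE.
have [n [b [ob sb]]] := Gram_Schmidt (codom e).
exists n, b; split=> // x; have [c ->] := spane x.
under [RHS]eq_bigr do rewrite dot_suml scaler_suml.
rewrite exchange_big; apply: eq_bigr => i _ /=.
rewrite {1}(sb (e i)) ?codom_f// scaler_sumr; apply: eq_bigr => j _.
by rewrite dotZl scalerA.
Qed.

(** The coordinates of the representative are the values of [l] on an orthonormal basis. This is
    what gives [grad] its meaning. *)
Lemma Riesz (l : {linear E -> R}) : exists g, forall h, dot g h = l h.
Proof.
have [n [b [_ sb]]] := orthonormal_basis.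
exists (\sum_(i < n) l (b i) *: b i) => h.
rewrite [in RHS](sb h) linear_sum dot_suml; apply: eq_bigr => i _.
by rewrite dotZl linearZ /= mulrC (dotC h).
Qed.

(** In finite dimension injectivity suffices, and [T x = 0] would make [dot (T x) x] vanish. It
    serves both [I + K] and the generally nonsymmetric [DF + K]. *)
Lemma posdef_surj (T : E -> E) : linear T ->
  (forall x, x != 0 -> 0 < dot (T x) x) -> forall y, exists x, T x = y.
Proof.
move=> linT posT y.
pose Tl := HB.pack_for {linear E -> E} T (GRing.isLinear.Build R E E *:%R T linT).
have [n [b [ob sb]]] := orthonormal_basis.
pose vec (r : 'rV[R]_n) := \sum_(i < n) r 0 i *: b i.
have vecb r j : dot (vec r) (b j) = r 0 j by exact: dot_orthonormal.
pose M := \matrix_(i, j) dot (T (b i)) (b j).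
have TM r j : dot (T (vec r)) (b j) = (r *m M) 0 j.
  rewrite -[T _]/(Tl _) linear_sum dot_suml mxE; apply: eq_bigr => i _.
  by rewrite linearZ dotZl mxE.
have Mfree : row_free M.
  apply/inj_row_free => r rM0.
  have v0 : vec r = 0.
    apply/eqP/negPn/negP => /posT.
    rewrite (sb (T _)) dot_suml big1 ?ltxx// => j _.
    by rewrite TM rM0 mxE scale0r dot0l.
  by apply/rowP => j; rewrite -vecb v0 dot0l mxE.
exists (vec ((\row_j dot y (b j)) *m invmx M)).
rewrite [LHS]sb [RHS]sb; apply: eq_bigr => j _.
by rewrite TM mulmxKV ?mxE// -row_free_unit.
Qed.

(** Heine-Borel is transported from row vectors: [A] is the image of its own preimage under the
    continuous map [vec]. *)
Lemma closed_bounded_compact (A : set E) (M : R) :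
  closed A -> (forall x, A x -> `|x| <= M) -> compact A.
Proof.
move=> clA bA; have [n [b [ob sb]]] := orthonormal_basis.
pose vec (r : 'rV[R]_n) := \sum_(i < n) r 0 i *: b i.
have vecb r j : dot (vec r) (b j) = r 0 j by exact: dot_orthonormal.
have cvec : continuous vec.
  move=> r; apply: differentiable_continuous.
  rewrite (_ : vec = \sum_(i < n) (fun r : 'rV[R]_n => r 0 i *: b i)); last first.
    by apply/funext => s; rewrite fct_sumE.
  apply: differentiable_sum => i; apply: differentiableZl.
  exact: differentiable_coord.
have -> : A = vec @` (vec @^-1` A).
  apply/seteqP; split=> [x Ax|_ [r Ar <-]//].
  exists (\row_i dot x (b i)).
    by rewrite /= /vec; under eq_bigr do rewrite mxE; rewrite -sb.
  by rewrite /vec; under eq_bigr do rewrite mxE; rewrite -sb.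
apply: continuous_compact; first exact: continuous_subspaceT.
apply: bounded_closed_compact; last first.
  by apply: closed_comp => // x _; exact: cvec.
exists M; split; first exact: num_real.
move=> M' MM' r /= /bA vM.
rewrite [leLHS]/Num.Def.normr /= mx_normrE; apply: bigmax_le.
  by rewrite (le_trans _ (ltW MM'))// (le_trans _ vM).
move=> [i j] _ /=; rewrite (ord1 i) -vecb.
rewrite (le_trans (abs_dot_le_norm _ _))// (le_trans _ (ltW MM'))//.
rewrite (_ : `|b j| = 1) ?mulr1//.
by apply/eqP; rewrite -sqrp_eq1// -dot_norm ob eqxx.
Qed.

End InnerProduct.

(** * Convexity and calculus along lines *)

Section Lines.
Context {R : realType} {E : normedModType R}.

(** A point displaced from the segment by a small [v] is a convex combination of the two endpoints
    displaced by the same [v]. *)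
Lemma interior_segment (X : set E) (x h : E) (t : R) : convex_set X ->
  X° x -> X° (x + h) -> 0 <= t <= 1 -> X° (x + t *: h).
Proof.
move=> cX /nbhs_ballP[r /= r0 Br] /nbhs_ballP[r' /= r'0 Br'] /andP[t0 t1].
apply/nbhs_ballP; exists (Num.min r r') => /=; first by rewrite lt_min r0.
move=> z; rewrite -ball_normE /= lt_min => /andP[zr zr'].
pose v := z - (x + t *: h).
have xX : x + v \in X.
  by apply/mem_set/Br; rewrite -ball_normE /= opprD addNKr normrN distrC.
have yX : x + h + v \in X.
  by apply/mem_set/Br'; rewrite -ball_normE /= opprD addNKr normrN distrC.
have t01 : Itv.spec (@Itv.num_sem R) (Itv.Real `[0%Z, 1%Z]) t.
  by rewrite /= /Itv.num_sem /= num_real /= in_itv /= t0 t1.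
have := cX _ _ (Itv.mk t01) yX xX.
rewrite inE /conv /=; congr X.
rewrite (addrC x h) -addrA scalerDr -addrA -scalerDl.
rewrite [_ + (1 - t)]subrKC scale1r addrC -addrA.
by rewrite (addrC v) addrA /v subrKC.
Qed.

Lemma line_is_derive (V : normedModType R) (g : E -> V) x h (t : R) :
  differentiable g (x + t *: h) ->
  is_derive t 1 (fun s => g (x + s *: h)) ('d g (x + t *: h) h).
Proof.
move=> dg.
have dl : is_diff t (fun s : R => x + s *: h) (fun s => s *: h).
  by apply: is_diff_eq; rewrite /= add0r.
have dgl : is_diff t (g \o (fun s : R => x + s *: h))
    ('d g (x + t *: h) \o (fun s => s *: h)).
  by apply: is_diff_comp; exact: differentiableP.
split; first by apply: diff_derivable; exact: ex_diff.
by rewrite deriveE; [rewrite diff_val /= scale1r|exact: ex_diff].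
Qed.

Lemma line_continuous (V : normedModType R) (g : E -> V) x h (t : R) :
  {for x + t *: h, continuous g} -> {for t, continuous (fun s : R => g (x + s *: h))}.
Proof.
move=> cg; apply: (@continuous_comp _ _ _ (fun s : R => x + s *: h) g) => //.
by apply: differentiable_continuous; apply: ex_diff.
Qed.

Lemma line_MVT (g : E -> R) x h (t : R) : 0 <= t ->
  (forall s, 0 <= s <= t -> differentiable g (x + s *: h)) ->
  exists2 c, 0 <= c <= t & g (x + t *: h) - g x = t * 'd g (x + c *: h) h.
Proof.
move=> t0 dg.
have [||c] := @MVT_segment R (fun s => g (x + s *: h))
  (fun s => 'd g (x + s *: h) h) 0 t t0.
- move=> s; rewrite in_itv /= => /andP[s0 st].
  by apply: line_is_derive; apply: dg; rewrite !ltW.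
- apply: continuous_in_subspaceT => s; rewrite inE /= in_itv /= => /dg ds.
  exact/line_continuous/differentiable_continuous.
by rewrite in_itv /= scale0r addr0 subr0 mulrC => ct e; exists c.
Qed.

End Lines.

(** * Gradient, Hessian and convexity of the barrier *)

Section Hessian.
Context {R : realType} {E : normedModType R} (dot : {dot E for idfun}).
Context (findimE : finite_dimensional E).
Context (dot_norm : forall x : E, dot x x = `|x| ^+ 2).
Context (X : set E) (f : E -> R).
Context (C3f : Ck 3 X° f) (fparam : barrier_parameters dot X f !=set0).

Lemma differentiable_f x : X° x -> differentiable f x.
Proof. by case: C3f => + _; exact. Qed.

Lemma differentiable_df h x : X° x -> differentiable (fun y => 'd f y h) x.
Proof. by case: C3f => _ /(_ h)[+ _]; exact. Qed.

Lemma differentiable_D2 h k x : X° x -> differentiable (fun y => D2 f y h k) x.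
Proof. by case: C3f => _ /(_ h)[_ /(_ k)[+ _]]; exact. Qed.

(** By Riesz the set in [grad] is never empty. As ['d f x] is linear at every [x], the identity also
    holds outside the interior and can rewrite [grad] as a function. *)
Lemma dot_grad x h : dot (grad dot f x) h = 'd f x h.
Proof.
have /getPex : [set g | forall h, dot g h = 'd f x h] !=set0.
  exact: (Riesz dot_norm findimE).
exact.
Qed.

Lemma differentiable_grad x : X° x -> differentiable (grad dot f) x.
Proof.
move=> xX; have [n [b [_ sb]]] := orthonormal_basis dot_norm findimE.
rewrite (_ : grad dot f = \sum_(i < n) (fun y => 'd f y (b i) *: b i)); last first.
  apply/funext => y; rewrite fct_sumE [LHS]sb.
  by apply: eq_bigr => i _; rewrite dot_grad.
by apply: differentiable_sum => i; exact/differentiableZl/differentiable_df.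
Qed.

(** Links the Hessian as derivative of [grad], found in the barrier parameter, with [D2], found in
    self-concordance. *)
Lemma dot_dgrad x h k : X° x -> dot h ('d (grad dot f) x k) = D2 f x h k.
Proof.
move=> xX; rewrite /D2.
rewrite (_ : (fun y => 'd f y h) = dot h \o grad dot f); last first.
  by apply/funext => y /=; rewrite -dot_grad (dotC dot).
have ch : continuous (dot h) by exact: dot_continuous.
rewrite diff_comp//=; [|exact: differentiable_grad|exact: linear_differentiable].
by rewrite diff_lin.
Qed.

(** Convexity comes from the barrier parameter: [t] times the Hessian form dominates a square. *)
Lemma Hessian_ge0 x h : X° x -> 0 <= dot h ('d (grad dot f) x h).
Proof.
move=> xX; have [t [+ ht]] := fparam.
(* The case [t = 0] forces [grad f = 0] on the whole interior. *)
rewrite le_eqVlt => /orP[/eqP t0|t0]; last first.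
  rewrite -(pmulr_rge0 _ t0); apply: le_trans (sqr_ge0 (dot (grad dot f x) h)) _.
  by rewrite -subr_ge0; exact: ht.
rewrite dot_dgrad// /D2 -deriveE; last exact: differentiable_df.
rewrite (@near_eq_derive _ _ _ _ (cst 0)) ?derive_cst//.
near=> y; have yX : X° y.
  by near: y; exact: (open_nbhs_nbhs (conj (@open_interior _ X) xX)).
have := ht y h yX; rewrite -t0 mul0r sub0r oppr_ge0 dot_grad => df0.
by apply/eqP; rewrite -sqrf_eq0 eq_le df0 sqr_ge0.
Unshelve. all: by end_near. Qed.

Context (cX : convex_set X).

Lemma grad_monotone x y : X° x -> X° y ->
  0 <= dot (grad dot f x - grad dot f y) (x - y).
Proof.
move=> xX yX; set h := x - y.
have seg s : 0 <= s <= 1 -> X° (y + s *: h).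
  by apply: interior_segment => //; rewrite subrKC.
have [c /seg Xc e] := @line_MVT _ _ (fun z => 'd f z h) y h 1 ler01
  (fun s hs => differentiable_df h (seg s hs)).
rewrite (dotBl dot) !dot_grad.
move: e; rewrite scale1r subrKC mul1r => ->.
by rewrite -[X in _ <= X]/(D2 f _ _ _) -dot_dgrad// Hessian_ge0.
Qed.

(** The mean value theorem gives the slope at some [x + c *: h]. Monotonicity of the gradient
    between this point and [x], divided by [c], compares it with the slope at [x]. *)
Lemma tangent_le x y : X° x -> X° y -> f x + 'd f x (y - x) <= f y.
Proof.
move=> xX yX; set h := y - x.
have seg s : 0 <= s <= 1 -> X° (x + s *: h).
  by apply: interior_segment => //; rewrite subrKC.
have [c c01] := @line_MVT _ _ f x h 1 ler01
  (fun s hs => differentiable_f (seg s hs)).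
rewrite scale1r subrKC mul1r => fyx.
rewrite -lerBrDl fyx -subr_ge0 -!dot_grad -(dotBl dot).
have := grad_monotone (seg c c01) xX.
have [->|c0] := eqVneq c 0; first by rewrite scale0r addr0 subrr !(dot0l dot).
rewrite addrAC subrr add0r (dotZr dot) pmulr_rge0//.
by rewrite lt_neqAle eq_sym c0; case/andP: c01.
Qed.

End Hessian.

(** * Differentiability in epsilon form *)

Section Frechet.
Context {R : realType} {V W : normedModType R}.

Lemma is_diff_eps (g : V -> W) (x : V) (L : {linear V -> W}) : continuous L ->
  (forall eps : R, 0 < eps ->
    \forall h \near 0, `|g (h + x) - g x - L h| <= eps * `|h|) ->
  is_diff x g L.
Proof.
move=> cL gL.
have gE : g \o shift x = cst (g x) + L +o_ 0 id.
  apply/eqaddoP => eps eps0; near=> h.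
  rewrite /= !fctE /= opprD addrA; near: h; exact: gL.
have dgL := diff_unique cL gE.
by split=> //; apply/diff_locallyP; rewrite dgL.
Unshelve. all: by end_near. Qed.

Lemma differentiable_eps (g : V -> W) (x : V) : differentiable g x ->
  forall eps : R, 0 < eps ->
    \forall h \near 0, `|g (h + x) - g x - 'd g x h| <= eps * `|h|.
Proof.
move=> /diff_locally /eqaddoP dg eps /dg; apply: filterS => h /=.
by rewrite !fctE /= opprD addrA.
Qed.

End Frechet.

(** * Closure points as limits of sequences *)

Section Closure.
Context {R : realType} {E : normedModType R}.

(** Turns closedness of a sublevel set into a question on sequences, the form in which [barrier]
    applies. *)
Lemma closure_seq (A : set E) (b : E) : closure A b ->
  exists u : nat -> E, (forall k, A (u k)) /\ u @ \oo --> b.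
Proof.
move=> Ab.
have /choice[u uP] (k : nat) : exists p, A p /\ `|b - p| < k.+1%:R^-1.
  have /Ab[p [Ap bp]] : nbhs b (ball b (k.+1%:R^-1 : R)).
    by apply: nbhsx_ballx; rewrite invr_gt0.
  by exists p; move: bp; rewrite -ball_normE.
exists u; split=> [k|]; first by case: (uP k).
apply/cvgrPdist_lt => eps eps0; near=> k.
have [_ /lt_trans] := uP k; apply; near: k; exact: near_infty_natSinv_lt (PosNum eps0).
Unshelve. all: by end_near. Qed.

End Closure.

(** * Existence and differentiability of [p_] *)

Section Prox.
Context {R : realType} {E : normedModType R} (dot : {dot E for idfun}).
Context (findimE : finite_dimensional E).
Context (dot_norm : forall x : E, dot x x = `|x| ^+ 2).
Context (X : set E) (f : E -> R).
Context (closedX : closed X) (cX : convex_set X) (intX : X° !=set0).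
Context (barrierf : barrier X f).
Context (C3f : Ck 3 X° f) (fparam : barrier_parameters dot X f !=set0).

Lemma normD_sqr (x y : E) : `|x + y| ^+ 2 = `|x| ^+ 2 + 2 * dot x y + `|y| ^+ 2.
Proof.
by rewrite -!dot_norm (dotDl dot) !(dotDr dot) (dotC dot y x); ring.
Qed.

Lemma prox_exists (c : R) z : 0 < c ->
  exists p, X° p /\ p + c *: grad dot f p = z.
Proof.
move=> c0; have [x0 x0X] := intX.
pose J p := c * f p + `|p - z| ^+ 2 / 2.
pose L := [set p | X° p /\ J p <= J x0].
have Jcont p : X° p -> {for p, continuous J}.
  move=> pX; apply: continuousD.
    apply: continuousM; first exact: cst_continuous.
    exact/differentiable_continuous/(differentiable_f C3f).
  apply: continuousM; last exact: cst_continuous.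
  apply: (@continuous_comp _ _ _ (fun p => `|p - z|) (fun r => r ^+ 2)).
    apply: (@continuous_comp _ _ _ (fun p => p - z) (fun r => `|r|)).
      by apply: continuousB => //; exact: cst_continuous.
    exact: norm_continuous.
  exact: exprn_continuous.
have compL : compact L.
  pose a := `|x0 - z|; pose G := `|grad dot f x0|.
  (* For the radius, let [d = |p - x0|]. The tangent at [x0] and [J p <= J x0] give
     [|p - z|^2 <= a^2 + 2 c G d]; since [d - a <= |p - z|], this forces [d <= 2 (a + c G)]. *)
  apply: (closed_bounded_compact dot_norm findimE (M := `|x0| + 2 * (a + c * G))).
    move=> b /closure_seq[u [uL ub]].
    have Xb : X b.
      apply: (closed_cvg _ closedX _ _ ub).
      by apply: nearW => k; apply: interior_subset; case: (uL k).
    have [Xob|Xob] := pselect (X° b).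
      split=> //; have Ju := cvg_comp _ _ ub (Jcont b Xob).
      apply: (closed_cvg [set r | r <= J x0] _ _ _ Ju); first exact: closed_le.
      by apply: nearW => k; case: (uL k).
    (* A limit on the boundary is impossible: [c * f (u k) <= J (u k) <= J x0] bounds [f] along a
       sequence on which the barrier diverges. *)
    exfalso.
    have /cvgryPge/(_ (J x0 / c + 1)) /filter_ex[k] : f (u k) @[k --> \oo] --> +oo.
      apply: (barrierf (b := b)) => // [k|]; first by case: (uL k).
      by split=> //; exact: subset_closure.
    apply/negP; rewrite -ltNge; apply: (@le_lt_trans _ _ (J x0 / c));
      last by rewrite ltrDl.
    rewrite ler_pdivlMr//; have [_] := uL k; apply: le_trans.
    by rewrite mulrC /J lerDl mulr_ge0// sqr_ge0.
  move=> p [pX pJ].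
  have dle : `|p - x0| <= `|p - z| + a.
    by rewrite /a (distrC x0) (le_trans _ (ler_normD _ _))// addrA subrK.
  have := tangent_le findimE dot_norm C3f fparam cX x0X pX.
  have := abs_dot_le_norm dot_norm (grad dot f x0) (p - x0).
  rewrite (dot_grad findimE dot_norm) ler_norml => /andP[dfge _] fge.
  have {dfge fge} fge : f x0 - G * `|p - x0| <= f p.
    by apply: le_trans fge; rewrite lerD2l.
  have [a0 G0] : 0 <= a /\ 0 <= G by rewrite !normr_ge0.
  suff d2 : `|p - x0| <= 2 * (a + c * G).
    by rewrite -[p](subrKC x0) (le_trans (ler_normD _ _))// lerD2l.
  move: pJ; rewrite /J -/a => pJ.
  have {}pJ : `|p - z| ^+ 2 <= a ^+ 2 + 2 * (c * G) * `|p - x0|.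
    by have := ler_wpM2l (ltW c0) fge; nra.
  have cG : 0 <= c * G by rewrite mulr_ge0// ltW.
  rewrite leNgt; apply/negP => d2.
  have : (`|p - x0| - a) ^+ 2 <= `|p - z| ^+ 2.
    by rewrite ler_sqr ?nnegrE//; lra.
  by have := normr_ge0 (p - x0); nra.
have Lx0 : L x0 by split.
have [|p /set_mem[pX pJ] pmin] := compact_EVT_min (f := J) (ex_intro _ x0 Lx0) compL.
  by apply: continuous_in_subspaceT => p /set_mem[/Jcont].
have {}pmin q : X° q -> J p <= J q.
  move=> qX; have [qJ|/ltW qJ] := leP (J q) (J x0); last exact: le_trans qJ.
  by apply: pmin; apply/mem_set.
exists p; split=> //; apply/eqP; rewrite -subr_eq0.
(* The defect [h] is itself the test direction: the derivative of [J] at [p] along [h] is [dot h h],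
   and it vanishes at the minimum. *)
set h := _ - z; rewrite -normr_eq0 -sqrf_eq0 -dot_norm; apply/eqP.
have /nbhs_ballP[e /= e0 eX] : nbhs (0 : R) [set t | X° (p + t *: h)].
  have : {for 0, continuous (fun t : R => p + t *: h)}.
    exact: (line_continuous (g := id)).
  apply; rewrite /= scale0r addr0.
  exact: (open_nbhs_nbhs (conj (@open_interior _ X) pX)).
have lX t : t \in `](- e), e[ -> X° (p + t *: h).
  by rewrite in_itv /= => te; apply: eX; rewrite -ball_normE /= sub0r normrN ltr_norml.
pose m t := J (p + t *: h).
have dm t : t \in `](- e), e[ ->
    is_derive t 1 m (c * 'd f (p + t *: h) h + dot (p - z) h + t * `|h| ^+ 2).
  move=> /lX Xt.
  have -> : m = (fun t => c * f (p + t *: h)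
      + (`|p - z| ^+ 2 / 2 + t * dot (p - z) h + t ^+ 2 * (`|h| ^+ 2 / 2))).
    apply/funext => s; rewrite /m /J; congr (_ + _).
    rewrite [p + s *: h - z]addrAC (normD_sqr (p - z)) (dotZr dot) normrZ.
    by rewrite exprMn (real_normK (num_real s)); field.
  have dl := line_is_derive (differentiable_f C3f Xt).
  apply: is_derive_eq; set D := 'd f _ h.
  by rewrite /GRing.scale /=; field.
have e0' : 0 \in `](- e), e[ by rewrite in_itv /= oppr_lt0 e0.
have m0 : is_derive (0 : R) 1 m 0.
  apply: (@derive1_at_min _ m (- e) e 0 _ _ e0').
  - by rewrite (@le_trans _ _ 0) ?oppr_le0 ?ltW.
  - by move=> t /dm[].
  - by move=> t /lX Xt; rewrite {1}/m scale0r addr0; exact: pmin.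
have := @derive_val _ _ _ _ _ _ _ m0.
rewrite (@derive_val _ _ _ _ _ _ _ (dm 0 e0')) scale0r addr0 mul0r addr0.
rewrite -(dot_grad findimE dot_norm) -(dotZl dot) -(dotDl dot).
by rewrite [c *: _ + _]addrCA addrA.
Qed.


(** Monotonicity of the gradient gives [|p - q|^2 <= dot d (p - q)], and Cauchy-Schwarz concludes.
    Read backwards, [p_] is 1-Lipschitz. *)
Lemma prox_lipschitz (c : R) p q : 0 < c -> X° p -> X° q ->
  `|p - q| <= `|p + c *: grad dot f p - (q + c *: grad dot f q)|.
Proof.
move=> c0 pX qX; set d := (X in _ <= `|X|).
have [->|pq] := eqVneq p q; first by rewrite subrr normr0.
rewrite -(ler_pM2r (x := `|p - q|)) ?normr_gt0 ?subr_eq0//.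
rewrite -expr2 -dot_norm (le_trans _ (dot_le_norm dot_norm _ _))//.
have -> : d = (p - q) + c *: (grad dot f p - grad dot f q).
  by rewrite /d opprD addrACA scalerBr.
rewrite [leRHS](dotDl dot) (dotZl dot) lerDl mulr_ge0 ?(ltW c0)//.
exact: (grad_monotone findimE dot_norm C3f fparam cX).
Qed.

Lemma p_spec (mu : R) z : 0 < mu ->
  X° (p_ dot X f mu z) /\
  p_ dot X f mu z + mu ^+ 2 *: grad dot f (p_ dot X f mu z) = z.
Proof.
move=> mu0; rewrite /p_ gt_eqF//.
have /(prox_exists z)[p pP] : 0 < mu ^+ 2 by rewrite exprn_gt0.
exact: (@getPex _ [set p | X° p /\ p + mu ^+ 2 *: grad dot f p = z] (ex_intro _ p pP)).
Qed.

(** [B] inverts [A = I + mu^2 D(grad f)]. Coercivity of [A] with constant 1 makes it bijective and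
    keeps [B] from increasing norms. *)
Lemma p_is_diff (mu : R) z : 0 < mu -> exists B : {linear E -> E},
  [/\ is_diff z (p_ dot X f mu) B,
    (forall y, B y + mu ^+ 2 *: 'd (grad dot f) (p_ dot X f mu z) (B y) = y) &
    (forall x, B (x + mu ^+ 2 *: 'd (grad dot f) (p_ dot X f mu z) x) = x)].
Proof.
move=> mu0; set P := p_ dot X f mu; set c := mu ^+ 2.
have c0 : 0 < c by rewrite exprn_gt0.
have [pX pz] := p_spec z mu0; rewrite -/P -/c in pX pz.
pose A h := h + c *: 'd (grad dot f) (P z) h.
have linA : linear A.
  move=> a x y; rewrite /A linearP scalerDr scalerDr !scalerA mulrC -addrACA.
  by rewrite -!scalerA.
have coA x : `|x| ^+ 2 <= dot (A x) x.
  rewrite (dotDl dot) (dotZl dot) dot_norm lerDl mulr_ge0 ?(ltW c0)//.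
  by rewrite (dotC dot) (Hessian_ge0 findimE dot_norm C3f fparam).
have Age x : `|x| <= `|A x|.
  have [->|x0] := eqVneq x 0; first by rewrite normr0.
  rewrite -(ler_pM2r (x := `|x|)) ?normr_gt0// -expr2 (le_trans (coA x))//.
  exact: dot_le_norm.
have /choice[B AB] : forall y, exists x, A x = y.
  apply: (posdef_surj dot_norm findimE linA) => x x0.
  by rewrite (lt_le_trans _ (coA x))// exprn_gt0// normr_gt0.
pose Al := HB.pack_for {linear E -> E} A (GRing.isLinear.Build R E E *:%R A linA).
have injA : injective A.
  move=> x y Axy; apply/eqP; rewrite -subr_eq0 -normr_le0.
  apply: le_trans (Age _) _.
  by rewrite -[A _]/(Al _) linearB /= Axy subrr normr0.
have linB : linear B by move=> a x y; apply: injA; rewrite linA !AB.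
pose Bl := HB.pack_for {linear E -> E} B (GRing.isLinear.Build R E E *:%R B linB).
have Bc y : `|B y| <= `|y| by rewrite -[in leRHS](AB y) Age.
exists Bl; split=> [|y|x]; last 2 first.
- exact: AB.
- by apply: injA; rewrite AB.
apply: is_diff_eps.
  apply: bounded_linear_continuous; apply/linear_boundedP; near=> r => x.
  rewrite (le_trans (Bc _))// ler_peMl//.
move=> eps eps0.
have /differentiable_eps/(_ (eps / c)) := differentiable_grad findimE dot_norm C3f pX.
rewrite divr_gt0// => /(_ isT)/nbhs_ballP[d /= d0 dP].
apply/nbhs_ballP; exists d => //= h; rewrite -ball_normE /= sub0r normrN => hd.
have [qX qz] := p_spec (h + z) mu0; rewrite -/P -/c in qX qz.
set k := P (h + z) - P z.
have kh : `|k| <= `|h|.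
  by apply: (le_trans (prox_lipschitz c0 qX pX)); rewrite qz pz addrK.
have := dP k; rewrite -ball_normE /= sub0r normrN => /(_ (le_lt_trans kh hd)).
rewrite subrK; set e := _ - _ - _ => ek.
(* Here [A (k - B h) = A k - h = - c e], where [e] is the remainder of the gradient over the
   increment [k]. As [|B e| <= |e|] and [|k| <= |h|], precision [eps / c] on [e] suffices. *)
have -> : k - Bl h = - (c *: B e).
  apply: injA; rewrite -![A _]/(Al _) linearB linearN linearZ /= !AB.
  have hE : h = k + c *: (grad dot f (P (h + z)) - grad dot f (P z)).
    by rewrite scalerBr /k addrACA -opprD qz pz addrK.
  by rewrite [X in _ - X = _]hE opprD addrACA subrr add0r -scalerBr -scalerN
    /e (opprB _ (_ k)) opprB.
rewrite normrN normrZ gtr0_norm//.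
rewrite (le_trans (y := c * (eps / c * `|k|)))//.
  by rewrite ler_pM2l// (le_trans (Bc _)).
by rewrite mulrA mulrCA divff ?gt_eqF// mulr1 ler_pM2l.
Unshelve. all: by end_near. Qed.

End Prox.

(** * A differential inequality with zero initial value *)

Section Gronwall.
Context {R : realType}.

(* Gronwall: [g] is bounded on [[0, t]] by some [M], so [g' <= 2 sqrt M g]. *)
Lemma self_concordant_ODE (g dg : R -> R) (t : R) : 0 <= t ->
  (forall s, 0 <= s <= t -> is_derive s 1 g (dg s)) ->
  (forall s, 0 <= s <= t -> 0 <= g s) ->
  (forall s, 0 <= s <= t -> dg s <= 2 * g s `^ (3 / 2)) ->
  g 0 = 0 -> g t = 0.
Proof.
move=> t0 gdg g0 dgle g00.
have cg : {within `[0, t], continuous g}.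
  apply: continuous_in_subspaceT => s; rewrite inE /= in_itv /= => /gdg[ds _].
  exact/differentiable_continuous/derivable1_diffP.
have [c] := EVT_max t0 cg; rewrite in_itv /= => ct gM.
pose K := 2 * g c `^ (1 / 2).
have dgK s : 0 <= s <= t -> dg s <= K * g s.
  move=> st; apply: (le_trans (dgle s st)).
  rewrite /K -mulrA ler_pM2l//.
  have -> : 3 / 2 = 1 / 2 + 1 :> R by lra.
  rewrite powRD; last by rewrite gt_eqF.
  rewrite powRr1 ?g0// ler_wpM2r ?g0//.
  by apply: ge0_ler_powR; rewrite ?nnegrE ?g0 ?gM ?in_itv.
pose k s := g s * expR (- K * s).
have dk s : 0 <= s <= t -> is_derive s 1 k ((dg s - K * g s) * expR (- K * s)).
  move=> /gdg ds; apply: is_derive_eq.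
  by rewrite /GRing.scale /=; ring.
have [||c' c't kt] := @MVT_segment R k
  (fun s => (dg s - K * g s) * expR (- K * s)) 0 t t0.
- by move=> s; rewrite in_itv /= => /andP[s0 st]; apply: dk; rewrite !ltW.
- apply: continuous_in_subspaceT => s; rewrite inE /= in_itv /= => /dk[ds _].
  exact/differentiable_continuous/derivable1_diffP.
have : k t <= 0.
  have -> : k t = k t - k 0 by rewrite /k g00 mul0r subr0.
  by rewrite kt subr0 mulr_le0_ge0// mulr_le0_ge0 ?expR_ge0// subr_le0 dgK//.
rewrite /k pmulr_lle0 ?expR_gt0// => gt0.
by apply/eqP; rewrite eq_le gt0 g0// lexx t0.
Qed.

End Gronwall.

(** * Positive definiteness of the Hessian, and lower bounds for the derivative of [F] *)

Section PositiveDefinite.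
Context {R : realType} {E : normedModType R} (dot : {dot E for idfun}).
Context (findimE : finite_dimensional E).
Context (dot_norm : forall x : E, dot x x = `|x| ^+ 2).
Context (X : set E) (f : E -> R).
Context (closedX : closed X) (cX : convex_set X).
Context (barrierf : barrier X f).
Context (C3f : Ck 3 X° f) (fparam : barrier_parameters dot X f !=set0).
Context (scf : forall x h, X° x -> `|D3 f x h h h| <= 2 * (D2 f x h h) `^ (3 / 2)).

(** [D3 f _ h h h] is the derivative of [D2 f _ h h] along the line, so self-concordance is the
    inequality of [self_concordant_ODE] and the zero persists. Two mean value steps, for [f] and for
    its slope, follow. *)
Lemma flat_line_affine x h (t : R) : D2 f x h h = 0 -> 0 <= t ->
  (forall s, 0 <= s <= t -> X° (x + s *: h)) ->
  f (x + t *: h) - f x = t * 'd f x h.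
Proof.
move=> flat t0 seg.
have D20 s : 0 <= s <= t -> D2 f (x + s *: h) h h = 0.
  move=> /andP[s0 st].
  have seg' r : 0 <= r <= s -> X° (x + r *: h).
    by move=> /andP[r0 rs]; apply: seg; rewrite r0 (le_trans rs).
  apply: (@self_concordant_ODE _ (fun s => D2 f (x + s *: h) h h)
    (fun s => D3 f (x + s *: h) h h h) s s0).
  - move=> r /seg' Xr; have dD2 := differentiable_D2 C3f h h Xr.
    exact: (line_is_derive dD2).
  - move=> r /seg' Xr.
    by rewrite -(dot_dgrad findimE dot_norm C3f)//
       (Hessian_ge0 findimE dot_norm C3f fparam).
  - by move=> r /seg' Xr; exact: le_trans (ler_norm _) (scf h Xr).
  - by rewrite scale0r addr0.
have [c /andP[c0 ct] ->] := line_MVT t0 (fun s hs => differentiable_f C3f (seg s hs)).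
have seg' r : 0 <= r <= c -> X° (x + r *: h).
  by move=> /andP[r0 rc]; apply: seg; rewrite r0 (le_trans rc).
have [c' /andP[c'0 c'c] /eqP] := line_MVT c0
  (fun s hs => differentiable_df C3f h (seg' s hs)).
rewrite -[X in _ == c * X]/(D2 f _ _ _) D20 ?c'0 ?(le_trans c'c)// mulr0.
by rewrite subr_eq0 => /eqP ->.
Qed.

(** Let [c] be the infimum of the exit times. At [c] the ray is on the boundary, but before [c] the
    function is affine, hence bounded, against the barrier property. *)
Lemma flat_ray_interior x h (t : R) : X° x -> D2 f x h h = 0 -> 0 <= t ->
  X° (x + t *: h).
Proof.
move=> xX flat t0; apply: contrapT => tX.
pose S := [set s : R | 0 <= s /\ ~ X° (x + s *: h)].
have infS : has_inf S.
  by split; [exists t|exists 0 => s []].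
set c := inf S.
have c0 : 0 <= c by apply: lb_le_inf; [case: infS|move=> s []].
have ltc s : 0 <= s < c -> X° (x + s *: h).
  move=> /andP[s0 sc]; apply: contrapT => sX.
  by have : c <= s; [apply: ge_inf => //; case: infS|rewrite leNgt sc].
have cont : {for c, continuous (fun s : R => x + s *: h)}.
  exact: (line_continuous (g := id)).
(* If this point were interior, so would be all nearby ones, yet exit times lie arbitrarily close to
   [c]. *)
have cNX : ~ X° (x + c *: h).
  move=> Xc.
  have /nbhs_ballP[e /= e0 eX] : nbhs c [set s : R | X° (x + s *: h)].
    by apply: cont; exact: (open_nbhs_nbhs (conj (@open_interior _ X) Xc)).
  have [s [s0 sX] sc] := inf_adherent e0 infS.
  apply/sX/eX; rewrite -ball_normE /= distrC ger0_norm ?ltrBlDl//.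
  by rewrite subr_ge0 ge_inf//; case: infS.
have cgt0 : 0 < c.
  rewrite lt_neqAle c0 andbT; apply/eqP => c0'.
  by apply: cNX; rewrite -c0' scale0r addr0.
(* As [harmonic k] is [1 / (k + 1)], these times start at 0, stay below [c] and tend to [c]. *)
pose s_ k : R := c * (1 - harmonic k).
have s_lt k : 0 <= s_ k < c.
  rewrite mulr_ge0//=; last by rewrite subr_ge0 invf_le1 ?ler1n.
  by rewrite gtr_pMr// ltrBlDr ltrDl invr_gt0.
have s_cvg : s_ @ \oo --> c.
  rewrite -[X in _ --> X]mulr1 -[X in _ * X]subr0.
  by apply: cvgM; [exact: cvg_cst|apply: cvgB; [exact: cvg_cst|exact: cvg_harmonic]].
have u_cvg : (fun k => x + s_ k *: h) @ \oo --> x + c *: h.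
  exact: (cvg_comp _ _ s_cvg cont).
have Xc : X (x + c *: h).
  apply: (closed_cvg _ closedX _ _ u_cvg).
  by apply: nearW => k; apply: interior_subset; exact: ltc.
have /cvgryPge/(_ (f x + c * `|'d f x h| + 1)) /filter_ex[k] :
    f (x + s_ k *: h) @[k --> \oo] --> +oo.
  apply: (barrierf (b := x + c *: h)) => // [k|]; first exact: ltc.
  by split=> //; exact: subset_closure.
apply/negP; rewrite -ltNge.
have /andP[sk0 skc] := s_lt k.
rewrite -[f (_ + _)](subrK (f x)) (flat_line_affine flat sk0); last first.
  by move=> r /andP[r0 rs]; apply: ltc; rewrite r0 (le_lt_trans rs).
have : s_ k * 'd f x h <= c * `|'d f x h|.
  by rewrite (le_trans (ler_norm _))// normrM ger0_norm// ler_wpM2r// ltW.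
lra.
Qed.

Lemma Hessian_gt0 x h : contains_no_line X -> X° x -> h != 0 ->
  0 < dot h ('d (grad dot f) x h).
Proof.
move=> noline xX h0; rewrite lt_neqAle.
rewrite (Hessian_ge0 findimE dot_norm C3f fparam)// andbT.
apply/eqP => /esym; rewrite (dot_dgrad findimE dot_norm C3f)// => flat.
apply: (noline x h h0) => t; apply: interior_subset.
have [t0|/ltW t0] := leP 0 t; first exact: flat_ray_interior.
(* For negative [t], follow the ray of [- h], along which the second derivative at [x] is zero as
   well. *)
rewrite -[t]opprK scaleNr -scalerN.
apply: flat_ray_interior; rewrite ?oppr_ge0//.
rewrite -(dot_dgrad findimE dot_norm C3f)// linearN -scaleN1r (dotZl dot).
rewrite -(scaleN1r ('d _ _ _)) (dotZr dot).
by rewrite (dot_dgrad findimE dot_norm C3f)// flat !mulr0.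
Qed.

(** The inequality between [t *: h + x] and [x], divided by [t ^+ 2], passes to the limit as [t]
    tends to 0. Taking [rho = 0] treats monotone maps. *)
Lemma dot_diff_ge (F : E -> E) (rho : R) (x h : E) : differentiable F x ->
  (forall x y, rho * `|x - y| ^+ 2 <= dot (F x - F y) (x - y)) ->
  rho * `|h| ^+ 2 <= dot ('d F x h) h.
Proof.
move=> dF Frho; rewrite -deriveE// (dotC dot).
have cvgF := diff_derivable (v := h) dF.
have ch : continuous (dot h) by exact: dot_continuous.
have cvgdot : dot h (t^-1 *: (F (t *: h + x) - F x)) @[t --> (0 : R)^'] -->
    dot h ('D_h F x) by exact: (cvg_comp _ _ cvgF (ch _)).
apply: (closed_cvg [set r | rho * `|h| ^+ 2 <= r] _ _ _ cvgdot); first exact: closed_ge.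
near=> t; have t0 : t != 0 by near: t; exact: nbhs_dnbhs_neq.
rewrite /= (dotZr dot) -(ler_pM2l (x := t ^+ 2)) ?exprn_even_gt0//.
have := Frho (t *: h + x) x; rewrite addrK normrZ exprMn (real_normK (num_real t)).
rewrite (dotZr dot) (dotC dot _ h) => H.
have -> : t ^+ 2 * (t^-1 * dot h (F (t *: h + x) - F x)) =
    t * dot h (F (t *: h + x) - F x) by field.
by rewrite mulrCA.
Unshelve. all: by end_near. Qed.

End PositiveDefinite.

(** * The linear system, operator norms and the product norm *)

Section NewtonSystem.
Context {R : realType} {E : normedModType R}.

(* [B] stands for [(I + K)^-1]; the substitution [s = u - a] eliminates it. *)
Lemma newton_system (T B K : {linear E -> E}) (u v a b : E) :
  (forall y, B y + K (B y) = y) -> (forall x, B (x + K x) = x) ->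
  (u - B (u - v) = a /\ T u - v = b) <->
  (v = a - K (u - a) /\ T (u - a) + K (u - a) = a + b - T a).
Proof.
move=> BK KB; split=> [[ua vb]|[va Tu]].
  have Buv : B (u - v) = u - a by rewrite -ua subKr.
  have va : v = a - K (u - a).
    have := BK (u - v); rewrite Buv => e.
    by rewrite -[LHS](subKr u) -e opprD addrA subKr.
  split=> //; rewrite -vb va linearB /= opprB addrCA subrKC.
  by rewrite addrAC.
have uv : u - v = (u - a) + K (u - a) by rewrite va opprB addrA addrAC.
split; first by rewrite uv KB subKr.
have e : T u + K (u - a) = a + b.
  by apply/(addIr (- T a)); rewrite -Tu (linearB T) /= addrAC.
by rewrite va opprB addrA e addrAC subrr add0r.
Qed.

(** Rescaling to the unit ball gives the homogeneous bound, and [v = 0] gives [0 <= M]. *)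
Lemma opnorm_le (A : {linear E -> E}) (M : R) :
  (opnorm Num.norm Num.norm A <= M%:E)%E -> 0 <= M /\ forall v, `|A v| <= M * `|v|.
Proof.
move=> /ereal_supP AM.
have AM1 v : `|v| <= 1 -> `|A v| <= M.
  by move=> v1; rewrite -lee_fin; apply: AM; exists v.
split=> [|v]; first by rewrite (le_trans _ (AM1 0 _)) ?normr0.
have [->|v0] := eqVneq v 0; first by rewrite linear0 !normr0 mulr0.
have nv : 0 < `|v| by rewrite normr_gt0.
have := AM1 (`|v|^-1 *: v); rewrite linearZ !normrZ normfV normr_id mulVf ?gt_eqF//.
by move=> /(_ (lexx _)); rewrite mulrC ler_pdivrMr.
Qed.

Lemma norm_fst_le_pnorm (w : E * E) : `|w.1| <= pnorm w.
Proof.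
apply: (@le_trans _ _ (Num.sqrt (`|w.1| ^+ 2))); first by rewrite sqrtr_sqr normr_id.
by rewrite ler_wsqrtr// lerDl sqr_ge0.
Qed.

Lemma norm_snd_le_pnorm (w : E * E) : `|w.2| <= pnorm w.
Proof.
apply: (@le_trans _ _ (Num.sqrt (`|w.2| ^+ 2))); first by rewrite sqrtr_sqr normr_id.
by rewrite ler_wsqrtr// lerDr sqr_ge0.
Qed.

Lemma pnorm_le_sum (w : E * E) : pnorm w <= `|w.1| + `|w.2|.
Proof.
rewrite /pnorm -[leRHS]ger0_norm ?addr_ge0// -[leRHS]sqrtr_sqr ler_sqrt ?sqr_ge0//.
by rewrite sqrrD lerD2r lerDl mulrn_wge0// mulr_ge0.
Qed.

End NewtonSystem.

(** * Invertibility of the derivative of [H_] and a bound on its inverse *)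

Section Nonsingular.
Context {R : realType} {E : normedModType R} (dot : {dot E for idfun}).
Context (findimE : finite_dimensional E).
Context (dot_norm : forall x : E, dot x x = `|x| ^+ 2).
Context (X : set E) (f : E -> R).
Context (closedX : closed X) (cX : convex_set X) (intX : X° !=set0).
Context (barrierf : barrier X f).
Context (C3f : Ck 3 X° f) (fparam : barrier_parameters dot X f !=set0).
Context (F : E -> E) (C1F : Ck 1 [set: E] F).

(** [K] is [mu ^+ 2] times the Hessian at [p]. It is exposed only through its relations with [B], as
    [newton_system] takes them, and its quadratic form, through which positivity enters. *)
Lemma H_is_diff (mu : R) (w : E * E) : 0 < mu ->
  exists B K : {linear E -> E},
  [/\ is_diff w (H_ dot X f F mu)
        (fun h => (h.1 - B (h.1 - h.2), 'd F (w.1) h.1 - h.2)),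
      forall y, B y + K (B y) = y, forall x, B (x + K x) = x &
      exists2 p, X° p & forall h, dot (K h) h = mu ^+ 2 * dot h ('d (grad dot f) p h)].
Proof.
move=> mu0.
have [B [dP BK KB]] := p_is_diff findimE dot_norm closedX cX intX barrierf C3f fparam
  (w.1 - w.2) mu0.
set p := p_ dot X f mu (w.1 - w.2) in BK KB.
exists B, (mu ^+ 2 \*: 'd (grad dot f) p); split=> //; last first.
  exists p.
    by case: (p_spec findimE dot_norm closedX cX intX barrierf C3f fparam
      (w.1 - w.2) mu0).
  by move=> h; rewrite (dotZl dot) (dotC dot).
have dfst : is_diff w (fst : E * E -> E) (fst : E * E -> E).
  have cfst : continuous (fst : E * E -> E) by move=> z; exact: cvg_fst.
  split; first exact: (@linear_differentiable _ _ _ fst).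
  exact: (@diff_lin _ _ _ fst).
have dsnd : is_diff w (snd : E * E -> E) (snd : E * E -> E).
  have csnd : continuous (snd : E * E -> E) by move=> z; exact: cvg_snd.
  split; first exact: (@linear_differentiable _ _ _ snd).
  exact: (@diff_lin _ _ _ snd).
have dF : is_diff (w.1) F ('d F (w.1)).
  by apply: differentiableP; case: C1F => + _; exact.
have dsub : is_diff w (fun v : E * E => v.1 - v.2) (fun v : E * E => v.1 - v.2).
  exact: is_diffB.
apply: (@is_diff_pair _ _ _ _ (phi dot X f mu) _ (fun v => F v.1 - v.2)).
Qed.

(** Positivity makes [DF + K] invertible, and [newton_system] carries this over. The hypothesis
    bears on the sum so that either term may supply strictness. *)
Lemma H_nonsingular (mu : R) (w : E * E) : 0 < mu ->
  (forall p h, X° p -> h != 0 ->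
    0 < dot ('d F (w.1) h) h + mu ^+ 2 * dot h ('d (grad dot f) p h)) ->
  nonsingular_diff (H_ dot X f F mu) w.
Proof.
move=> mu0 pos; have [B [K [dH BK KB [p pX Kp]]]] := H_is_diff w mu0.
split; first exact: ex_diff.
rewrite diff_val.
pose T := 'd F (w.1).
have posTK h : h != 0 -> 0 < dot (T h + K h) h.
  by move=> h0; rewrite (dotDl dot) Kp; exact: pos.
have lTK : linear (fun h => T h + K h).
  by move=> a x y; rewrite !linearP scalerDr addrACA.
have /choice[S TS] := posdef_surj dot_norm findimE lTK posTK.
have injTK s t : T s + K s = T t + K t -> s = t.
  move=> e; apply/eqP; rewrite -subr_eq0; apply: contraTT isT => /posTK.
  by rewrite (linearB T) (linearB K) addrACA -opprD e subrr (dot0l dot) ltxx.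
(* [s] solves [(T + K) s = a + b - T a]; the preimage is then [u = s + a], [v = a - K s]. *)
pose s r := S (r.1 + r.2 - T r.1).
exists (fun r : E * E => (s r + r.1, r.1 - K (s r))).
- move=> [u v] /=; have /(newton_system T _ _ _ _ BK KB)[] :=
    conj (erefl (u - B (u - v))) (erefl (T u - v)).
  set a := _ - B _; set b := _ - v => va Tu.
  have -> : s (a, b) = u - a by apply: injTK; rewrite TS -Tu.
  by rewrite -va subrK.
- move=> [a b] /=; set u := _ + a; set v := a - _.
  have sE : s (a, b) = u - a by rewrite addrK.
  have [-> ->] // : u - B (u - v) = a /\ T u - v = b.
  apply/(newton_system T _ _ _ _ BK KB); rewrite -sE; split=> //.
  exact: TS.
Qed.

(** For [|a|, |b| <= 1] the right-hand side [a + b - DF a] has norm at most [2 + M], so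
    [|s| <= (2 + M) / rho]. Hence [|u| <= U] with [U = (2 + M) / rho + 1], and [|v| <= M U + 1]; the
    sum is the constant. *)
Lemma inverse_H_bound (mu rho M : R) (w : E * E) : 0 < mu -> 0 < rho ->
  (forall x y, rho * `|x - y| ^+ 2 <= dot (F x - F y) (x - y)) ->
  nonsingular_diff (H_ dot X f F mu) w ->
  (opnorm Num.norm Num.norm ('d F (w.1)) <= M%:E)%E ->
  (opnorm pnorm pnorm (inverse ('d (H_ dot X f F mu) w)) <=
    ((1 + M) * ((2 + M) / rho + 1) + 1)%:E)%E.
Proof.
move=> mu0 rho0 Frho [_ bijH] /opnorm_le[M0 FM].
have [B [K [dH BK KB [p pX Kp]]]] := H_is_diff w mu0.
apply/ereal_supP => _ [r /= r1 <-]; rewrite lee_fin.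
have [g _ gK] := bijH.
(* Surjectivity ensures that the [get] in [inverse] returns a true preimage. *)
have : 'd (H_ dot X f F mu) w (inverse ('d (H_ dot X f F mu) w) r) = r.
  exact: (@getPex _ [set x | 'd (H_ dot X f F mu) w x = r] (ex_intro _ (g r) (gK r))).
move: (inverse _ _) => [u v]; rewrite diff_val; case: r r1 => a b r1 /= [ua Tb].
have /(newton_system ('d F (w.1)) _ _ _ _ BK KB)[va TKs] := conj ua Tb.
have a1 : `|a| <= 1 by apply: le_trans r1; exact: (norm_fst_le_pnorm (a, b)).
have b1 : `|b| <= 1 by apply: le_trans r1; exact: (norm_snd_le_pnorm (a, b)).
have sle : `|u - a| <= (2 + M) / rho.
  rewrite ler_pdivlMr//.
  have [->|s0] := eqVneq (u - a) 0; first by rewrite normr0 mul0r addr_ge0.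
  rewrite -(ler_pM2r (x := `|u - a|)) ?normr_gt0// mulrAC -expr2 mulrC.
  apply: (@le_trans _ _ (dot ('d F (w.1) (u - a) + K (u - a)) (u - a))).
    rewrite (dotDl dot) Kp -[leLHS]addr0 lerD//.
      by apply: dot_diff_ge => //; case: C1F => + _; exact.
    by rewrite mulr_ge0 ?exprn_ge0 ?(ltW mu0)//
       (Hessian_ge0 findimE dot_norm C3f fparam).
  rewrite TKs (le_trans (dot_le_norm dot_norm _ _))// ler_wpM2r//.
  rewrite (le_trans (ler_normB _ _))// lerD//.
    by rewrite (le_trans (ler_normD _ _))//; lra.
  by rewrite (le_trans (FM a))// ler_piMr.
have ule : `|u| <= (2 + M) / rho + 1.
  by rewrite -[u](subrK a) (le_trans (ler_normD _ _))// lerD.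
have vle : `|v| <= M * ((2 + M) / rho + 1) + 1.
  (* Taking [v] from the second equation, instead of [a - K s], keeps any bound on [K] out of the
     estimate. *)
  have -> : v = 'd F (w.1) u - b by rewrite -Tb subKr.
  rewrite (le_trans (ler_normB _ _))// lerD//.
  by rewrite (le_trans (FM u))// ler_wpM2l.
rewrite (le_trans (pnorm_le_sum _))//=; lra.
Qed.

End Nonsingular.

(** * Assembly of the monotone and the strongly monotone case *)

Theorem proposition6 (R : realType) (E : normedModType R)
  (dot : {dot E for idfun})
  (findimE : finite_dimensional E)
  (dot_norm : forall x : E, dot x x = `|x| ^+ 2)
  (X : set E) (F : E -> E) (f : E -> R) (vartheta : R)
  (closedX : closed X) (convexX : convex_set X) (intX : X° !=set0)
  (C1F : Ck 1 [set: E] F)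
  (barrierf : self_concordant_barrier dot X f vartheta) :
  (monotone dot F -> contains_no_line X ->
     forall mu : R, 0 < mu ->
     forall x y : E, nonsingular_diff (H_ dot X f F mu) (x, y)) /\
  (strongly_monotone dot F ->
     forall (d : alg_data) (stop : option nat)
       (mu : nat -> R) (w : nat -> E * E),
     admissible vartheta d ->
     generated dot X f F d stop mu w ->
     (forall k, index_of_run stop k -> 0 < mu k) ->
     (exists M : R, forall k, index_of_run stop k ->
        (opnorm Num.norm Num.norm ('d F ((w k).1)) <= M%:E)%E) ->
     (forall k, index_of_run stop k ->
        nonsingular_diff (H_ dot X f F (mu k)) (w k)) /\
     (exists C : R, forall k, index_of_run stop k ->
        (opnorm pnorm pnorm (inverse ('d (H_ dot X f F (mu k)) (w k)))
           <= C%:E)%E)).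
Proof.
have [barf C3f fparam _ scf] := barrierf.
have dF x : differentiable F x by case: C1F => + _; exact.
split=> [monoF noline mu mu0 x y|[rho rho0 Frho] d stop mu w _ _ mu0 [M FM]].
  (* Strictness comes from the Hessian here; monotonicity enters as [dot_diff_ge] with [rho = 0]. *)
  apply: H_nonsingular => // p h pX h0; apply: ltr_wpDl.
    rewrite -(mul0r (`|h| ^+ 2)); apply: dot_diff_ge => // x' y'.
    by rewrite mul0r.
  rewrite mulr_gt0 ?exprn_gt0//.
  exact: (Hessian_gt0 findimE dot_norm closedX barf C3f fparam scf).
have nonsing k : index_of_run stop k -> nonsingular_diff (H_ dot X f F (mu k)) (w k).
  (* Strictness now comes from ['d F], the Hessian term being nonnegative. *)
  move=> /mu0 muk; apply: H_nonsingular => // p h pX h0; apply: ltr_wpDr.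
    by rewrite mulr_ge0 ?exprn_ge0 ?(ltW muk)//
       (Hessian_ge0 findimE dot_norm C3f fparam).
  apply: lt_le_trans (dot_diff_ge dot_norm h (dF _) Frho).
  by rewrite mulr_gt0// exprn_gt0// normr_gt0.
split=> //; exists ((1 + M) * ((2 + M) / rho + 1) + 1) => k ki.
by apply: inverse_H_bound => //; [exact: mu0|exact: nonsing|exact: FM].
Qed.
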